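(* If the inverse semigroup $\Gamma$ satisfies condition (L) and has a zero, then the family of sets $V_x$, $x\in\Gamma$, is a basis of the topology of $G_m(\Gamma)$.
   Context: In an inverse semigroup, $x\prec y$ means $xy^{-1}=xx^{-1}$ (natural partial order); then $x$ is called a precessor of $y$. The symbol $0$ denotes the (unique) element $z$ with $z\prec x$ for all $x$, if it exists; conditions ''$\neq0$'' are vacuous otherwise. An element $x$ is minimal if $x\neq0$ and $y\prec x$, $y\ne0$ implies $y=x$. Condition (L): any $x,y\in\Gamma$ having a common precessor not equal to zero have a largest common precessor. A subset $A\subset\Gamma$ is directed if it is nonempty and any two elements of $A$ have a common $\prec$-lower bound in $A$. For directed sets write $A\prec B$ if for every $b\in B$ there is $a\in A$ with $a\prec b$, and $A\sim B$ if $A\prec B$ and $B\prec A$. $\mathcal{O}(\Gamma)$ is the set of $\sim$-classes $[A]$ of directed sets; with $[A][B]=[AB]$ and $[A]^{-1}=[A^{-1}]$ (elementwise) it is an inverse semigroup whose natural order is $[A]\prec[B]\iff A\prec B$. For $x\in\Gamma$ write $x$ also for $[\{x\}]$. $G_u(\Gamma)$ is the groupoid with underlying set $\mathcal{O}(\Gamma)$, the inversion of $\mathcal{O}(\Gamma)$, and product $XY$ defined iff $X^{-1}X=YY^{-1}$. For $x_1,\ldots,x_n\prec x$ in $\Gamma$ ($n\ge0$), with $U_x=\{X:X\prec x\}$, put $U_{x;x_1,\ldots,x_n}=U_x\cap U_{x_1}^c\cap\cdots\cap U_{x_n}^c$; these sets are a basis of the topology of $G_u(\Gamma)$. $G_m(\Gamma)$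 is the subgroupoid of $G_u(\Gamma)$ consisting of the minimal elements of $\mathcal{O}(\Gamma)$, with the subspace topology, and $V_x=U_x\cap G_m(\Gamma)$ for $x\in\Gamma$. *)

(* Defs.v *)
From HB Require Import structures.
From mathcomp Require Import all_boot generic_quotient.
From mathcomp Require Import boolp classical_sets functions topology.

Set Implicit Arguments.
Unset Strict Implicit.
Unset Printing Implicit Defensive.

Local Open Scope classical_set_scope.

Local Open Scope quotient_scope.
Local Open Scope group_scope.

HB.mixin Record Semigroup_isInverse G of Semigroup G := {
  sinv : G -> G;
  mul_sinv_mul : forall x : G, x * sinv x * x = x;
  sinv_mul_sinv : forall x : G, sinv x * x * sinv x = sinv x;
  sinv_uniq : forall x y : G, x * y * x = x -> y * x * y = y -> y = sinv x
}.

#[short(type="inverseSemigroupType")]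
HB.structure Definition InverseSemigroup :=
  {G of Semigroup_isInverse G & Semigroup G}.

Section NaturalOrder.
Variable G : inverseSemigroupType.
Implicit Types x y z : G.

Definition prec x y : Prop := x * sinv y = x * sinv x.

Definition is_zero z : Prop := forall x, prec z x.

Definition has_zero : Prop := exists z, is_zero z.

(* [~ is_zero x] expresses "x <> 0", and holds of every x when G has no
   zero. *)
Definition minimal x : Prop :=
  ~ is_zero x /\ forall y, prec y x -> ~ is_zero y -> y = x.

Definition conditionL : Prop :=
  forall x y, (exists z, [/\ prec z x, prec z y & ~ is_zero z]) ->
  exists w, [/\ prec w x, prec w y &
    forall z, prec z x -> prec z y -> prec z w].

Definition idem x : Prop := x * x = x.

Let mulA := @mulgA G.

Lemma sinvK x : sinv (sinv x) = x.
Proof. by apply/esym/sinv_uniq; rewrite ?sinv_mul_sinv ?mul_sinv_mul. Qed.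

Lemma idem_sinv x : idem x -> sinv x = x.
Proof. by move=> e; apply/esym/sinv_uniq; rewrite !e. Qed.

Lemma idem_mulV x : idem (x * sinv x).
Proof. by rewrite /idem mulA mul_sinv_mul. Qed.

Lemma idem_mulVl x : idem (sinv x * x).
Proof. by rewrite /idem mulA sinv_mul_sinv. Qed.

Lemma idem_mul x y : idem x -> idem y -> idem (x * y).
Proof.
move=> ex ey; set z := y * sinv (x * y) * x.
have zK : x * y * z * (x * y) = x * y.
  rewrite /z !mulA -(mulA x y y) ey -(mulA _ x x) ex.
  by rewrite -[RHS]mul_sinv_mul !mulA.
have Kz : z * (x * y) * z = z.
  rewrite /z !mulA -(mulA _ x x) ex -(mulA _ y y) ey.
  by rewrite -{3}(sinv_mul_sinv (x * y)) !mulA.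
have ez : idem z.
  have /(congr1 (fun t => y * t * x)) := sinv_mul_sinv (x * y).
  by rewrite /idem /z !mulA.
by have := sinv_uniq _ _ Kz zK; rewrite (idem_sinv ez) => ->.
Qed.

Lemma idemC x y : idem x -> idem y -> x * y = y * x.
Proof.
move=> ex ey; rewrite -{1}(idem_sinv (idem_mul ex ey)); apply/esym/sinv_uniq.
  rewrite !mulA -(mulA x y y) ey -(mulA _ x x) ex.
  by rewrite -mulA; apply: idem_mul.
rewrite !mulA -(mulA y x x) ex -(mulA _ y y) ey.
by rewrite -mulA; apply: idem_mul.
Qed.

Lemma sinvM x y : sinv (x * y) = sinv y * sinv x.
Proof.
have C := idemC (idem_mulV y) (idem_mulVl x).
apply/esym/sinv_uniq.
  transitivity (x * ((y * sinv y) * (sinv x * x)) * y); first by rewrite !mulA.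
  by rewrite C !mulA mul_sinv_mul -!mulA (mulA y) mul_sinv_mul.
transitivity (sinv y * ((sinv x * x) * (y * sinv y)) * sinv x); first by rewrite !mulA.
by rewrite -C !mulA sinv_mul_sinv -!mulA (mulA (sinv x)) sinv_mul_sinv.
Qed.

Lemma prec_r x y : prec x y -> x = y * (sinv x * x).
Proof.
move=> h; have := congr1 (@sinv G) h.
by rewrite !sinvM !sinvK => h'; rewrite mulA h' mul_sinv_mul.
Qed.

Lemma prec_of_r x y f : idem f -> x = y * f -> prec x y.
Proof.
move=> ef ->; rewrite /prec sinvM (idem_sinv ef) mulA -(mulA y f f).
by rewrite ef.
Qed.

Lemma idem_conj x e : idem e -> idem (x * e * sinv x).
Proof.
move=> ee; rewrite /idem !mulA -(mulA _ (sinv x) x) -(mulA x e).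
rewrite (idemC ee (idem_mulVl x)) !mulA mul_sinv_mul.
by rewrite -(mulA _ e e) ee.
Qed.

Lemma prec_of_l x y e : idem e -> x = e * y -> prec x y.
Proof.
move=> ee ->; apply: (@prec_of_r _ _ (sinv y * e * y)).
  by have := idem_conj (sinv y) ee; rewrite sinvK.
rewrite !mulA (idemC (idem_mulV y) ee).
by rewrite -(mulA e) mul_sinv_mul.
Qed.

Lemma prec_l x y : prec x y -> x = (x * sinv x) * y.
Proof.
move=> h; have ex := prec_r h; rewrite -h.
transitivity (y * (sinv x * x) * sinv y * y); last by rewrite -ex.
rewrite -!mulA (mulA (sinv x)) (idemC (idem_mulVl x) (idem_mulVl y)).
by rewrite !mulA mul_sinv_mul -mulA.
Qed.

Lemma precxx x : prec x x.
Proof. by []. Qed.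

Lemma prec_trans y x z : prec x y -> prec y z -> prec x z.
Proof.
move=> /prec_l xy /prec_l yz.
apply: (@prec_of_l _ _ ((x * sinv x) * (y * sinv y))).
  exact: idem_mul (idem_mulV x) (idem_mulV y).
by rewrite -mulA -yz.
Qed.

Lemma prec_mul x y z w : prec x y -> prec z w -> prec (x * z) (y * w).
Proof.
move=> /prec_l xy /prec_r zw.
apply: (@prec_trans (y * z)).
  by apply: (@prec_of_l _ _ (x * sinv x)); [exact: idem_mulV|rewrite mulA -xy].
by apply: (@prec_of_r _ _ (sinv z * z)); [exact: idem_mulVl|rewrite -mulA -zw].
Qed.

Lemma prec_inv x y : prec x y -> prec (sinv x) (sinv y).
Proof.
move=> /prec_l xy; apply: (@prec_of_r _ _ (x * sinv x)); first exact: idem_mulV.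
by rewrite {1}xy sinvM (idem_sinv (idem_mulV x)).
Qed.

Lemma idem_of_prec f g d : prec f d -> prec g d -> g = sinv f * f -> f = g.
Proof.
move=> /prec_r fd /prec_r gd eg.
have ig : idem g by rewrite /idem {1 2}eg idem_mulVl.
by rewrite fd -eg {2}gd (idem_sinv ig) ig.
Qed.

Lemma prec_meetl x y z : prec y x -> prec z x -> prec (y * sinv y * z) y.
Proof.
move=> /prec_l yx /prec_l zx.
apply: (@prec_of_l _ _ (z * sinv z)); first exact: idem_mulV.
rewrite {1}zx mulA (idemC (idem_mulV y) (idem_mulV z)).
by rewrite -mulA -yx.
Qed.

Lemma prec_meetr y z : prec (y * sinv y * z) z.
Proof. exact: (prec_of_l (idem_mulV y) erefl). Qed.

Lemma prec_meet y z w : prec w y -> prec w z -> prec w (y * sinv y * z).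
Proof.
move=> wy wz; rewrite -[w]mul_sinv_mul.
by apply: prec_mul wz; apply: prec_mul wy (prec_inv wy).
Qed.

Definition directed (A : set G) : Prop :=
  A !=set0 /\
  forall a b, A a -> A b -> exists c, [/\ A c, prec c a & prec c b].

Definition dprec (A B : set G) : Prop :=
  forall b, B b -> exists2 a, A a & prec a b.

Definition dsim (A B : set G) : Prop := dprec A B /\ dprec B A.

Definition set_mul (A B : set G) : set G := [set a * b | a in A & b in B].
Definition set_inv (A : set G) : set G := [set sinv a | a in A].

Lemma dprec_refl A : dprec A A.
Proof. by move=> a Aa; exists a. Qed.

Lemma dprec_trans B A C : dprec A B -> dprec B C -> dprec A C.
Proof.
move=> AB BC c /BC[b /AB[a Aa ab] bc].
by exists a => //; exact: prec_trans ab bc.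
Qed.

Lemma dsim_refl A : dsim A A.
Proof. by split; exact: dprec_refl. Qed.

Lemma dsim_sym A B : dsim A B -> dsim B A.
Proof. by case. Qed.

Lemma dsim_trans B A C : dsim A B -> dsim B C -> dsim A C.
Proof. by move=> [? ?] [? ?]; split; apply: (@dprec_trans B). Qed.

Lemma dprec_mul A A' B B' :
  dprec A A' -> dprec B B' -> dprec (set_mul A B) (set_mul A' B').
Proof.
move=> AA BB _ [a /AA[a' ha la] [b /BB[b' hb lb] <-]].
by exists (a' * b'); [exists a' => //; exists b'|exact: prec_mul].
Qed.

Lemma dsim_mul A A' B B' :
  dsim A A' -> dsim B B' -> dsim (set_mul A B) (set_mul A' B').
Proof. by move=> [? ?] [? ?]; split; apply: dprec_mul. Qed.

Lemma dprec_inv A B : dprec A B -> dprec (set_inv A) (set_inv B).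
Proof.
move=> AB _ [b /AB[a Aa ab] <-].
by exists (sinv a); [exists a|exact: prec_inv].
Qed.

Lemma dsim_inv A B : dsim A B -> dsim (set_inv A) (set_inv B).
Proof. by move=> [? ?]; split; apply: dprec_inv. Qed.

Lemma directed1 x : directed [set x].
Proof.
by split; [exists x|move=> a b -> ->; exists x].
Qed.

Lemma directed_mul A B : directed A -> directed B -> directed (set_mul A B).
Proof.
move=> [[a0 Aa0] dA] [[b0 Bb0] dB]; split.
  by exists (a0 * b0); exists a0 => //; exists b0.
move=> _ _ [a Aa [b Bb <-]] [a' Aa' [b' Bb' <-]].
have [c [Ac ca ca']] := dA _ _ Aa Aa'.
have [d [Bd db db']] := dB _ _ Bb Bb'.
exists (c * d); split; [by exists c => //; exists d|exact: prec_mul..].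
Qed.

Lemma directed_inv A : directed A -> directed (set_inv A).
Proof.
move=> [[a0 Aa0] dA]; split; first by exists (sinv a0); exists a0.
move=> _ _ [a Aa <-] [b Ab <-]; have [c [Ac ca cb]] := dA _ _ Aa Ab.
by exists (sinv c); split; [exists c|exact: prec_inv..].
Qed.

Lemma set_mulA A B C : set_mul A (set_mul B C) = set_mul (set_mul A B) C.
Proof.
apply/seteqP; split.
  move=> _ [a Aa [_ [b Bb [c Cc <-]] <-]].
  by exists (a * b); [exists a => //; exists b|exists c => //; rewrite mulA].
move=> _ [_ [a Aa [b Bb <-]] [c Cc <-]].
by exists a => //; exists (b * c); [exists b => //; exists c|rewrite mulA].
Qed.

Lemma set_invK A : set_inv (set_inv A) = A.
Proof.
apply/seteqP; split; first by move=> _ [_ [a Aa <-] <-]; rewrite sinvK.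
by move=> a Aa; exists (sinv a); [exists a|rewrite sinvK].
Qed.

Lemma dsim_regular A : directed A -> dsim (set_mul (set_mul A (set_inv A)) A) A.
Proof.
move=> [_ dA]; split.
  move=> a Aa; exists a => //; exists (a * sinv a); last first.
    by exists a => //; exact: mul_sinv_mul.
  by exists a => //; exists (sinv a) => //; exists a.
move=> _ [_ [a Aa [_ [b Ab <-] <-]] [c Ac <-]].
have [d [Ad da db]] := dA _ _ Aa Ab; have [e [Ae ed ec]] := dA _ _ Ad Ac.
exists e => //; rewrite -[e]mul_sinv_mul; apply: prec_mul ec.
by apply: prec_mul; [|apply: prec_inv]; exact: (@prec_trans d).
Qed.

Lemma directed_idem A : directed A -> dsim (set_mul A A) A ->
  dsim A (A `&` [set x | idem x]).
Proof.
move=> [_ dA] [AAA AAA']; split; first by move=> a [Aa _]; exists a.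
move=> a Aa; have [_ [b Ab [c Ac <-]] bca] := AAA _ Aa.
have [d0 [Ad0 d0b d0c]] := dA _ _ Ab Ac.
have [d [Ad dd0 da]] := dA _ _ Ad0 Aa.
have /AAA'[f1 Af1 f1d] : set_mul A A (d * d) by exists d => //; exists d.
have [f [Af ff1 fd]] := dA _ _ Af1 Ad.
have {}f1d := prec_trans ff1 f1d.
exists f; last exact: prec_trans fd da.
split=> //.
have fE := prec_l fd.
have ffd : f = f * d by rewrite {1}(prec_l f1d) mulA -fE.
have gd : prec (sinv f * f) d.
  apply: (@prec_of_l _ _ (sinv f * f)); first exact: idem_mulVl.
  by rewrite -mulA -ffd.
by rewrite /= (idem_of_prec fd gd erefl); exact: idem_mulVl.
Qed.

Lemma dsim_idemC A B : directed A -> directed B ->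
  dsim (set_mul A A) A -> dsim (set_mul B B) B ->
  dsim (set_mul A B) (set_mul B A).
Proof.
move=> dA dB /(directed_idem dA) hA /(directed_idem dB) hB.
apply: dsim_trans (dsim_mul hA hB) _.
apply: dsim_trans (dsim_sym (dsim_mul hB hA)).
suff -> : set_mul (A `&` [set x | idem x]) (B `&` [set x | idem x]) =
          set_mul (B `&` [set x | idem x]) (A `&` [set x | idem x]).
  exact: dsim_refl.
apply/seteqP; split=> _ [a [Aa ia] [b [Bb ib] <-]];
by exists b => //; exists a => //; exact: idemC.
Qed.

Lemma dprec_mulP A B : directed A -> directed B ->
  dsim (set_mul A (set_inv B)) (set_mul A (set_inv A)) <-> dprec A B.
Proof.
move=> [[a0 Aa0] dA] [[b0 Bb0] dB]; split=> [AB|AB].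
  have dAA : directed A by split=> //; exists a0.
  have dBB : directed B by split=> //; exists b0.
  have := dsim_inv AB.
  have E C D : set_inv (set_mul C (set_inv D)) = set_mul D (set_inv C).
    apply/seteqP; split.
      move=> _ [_ [c Cc [_ [d Dd <-] <-]] <-].
      by exists d => //; exists (sinv c); [exists c|rewrite sinvM sinvK].
    move=> _ [d Dd [_ [c Cc <-] <-]].
    exists (c * sinv d); last by rewrite sinvM sinvK.
    by exists c => //; exists (sinv d) => //; exists d.
  rewrite !E => /dsim_mul/(_ (dsim_refl A))/dsim_sym.
  move=> /(dsim_trans (dsim_sym (dsim_regular dAA)))[AB' _] b Bb.
  have [c Ac cE] : exists2 c, A c & prec c (b * sinv a0 * a0).
    by apply: AB'; exists (b * sinv a0); [exists b => //; exists (sinv a0) => //; exists a0|exists a0].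
  exists c => //; apply: prec_trans cE _; rewrite -mulA.
  exact: (prec_of_r (idem_mulVl a0) erefl).
split.
  move=> _ [a Aa [_ [a' Aa' <-] <-]].
  have [c [Ac ca ca']] := dA _ _ Aa Aa'.
  have [d Ad db] := AB _ Bb0; have [e [Ae ec ed]] := dA _ _ Ac Ad.
  exists (e * sinv b0); first by exists e => //; exists (sinv b0) => //; exists b0.
  have -> : e * sinv b0 = e * sinv e by exact: prec_trans ed db.
  by apply: prec_mul; [|apply: prec_inv]; exact: (@prec_trans c).
move=> _ [a Aa [_ [b /AB[c Ac cb] <-] <-]].
exists (a * sinv c); first by exists a => //; exists (sinv c) => //; exists c.
by apply: prec_mul => //; exact: prec_inv.
Qed.

End NaturalOrder.

Section DirectedClasses.
Variable G : inverseSemigroupType.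

Definition directed_set : Type := set_type (@directed G).
HB.instance Definition _ := Choice.on directed_set.

Definition dsimb : rel directed_set := fun A B => `[< dsim (sval A) (sval B) >].

Lemma dsimb_refl : reflexive dsimb.
Proof. by move=> A; apply/asboolP/dsim_refl. Qed.

Lemma dsimb_sym : symmetric dsimb.
Proof. by move=> A B; apply/asboolP/asboolP; exact: dsim_sym. Qed.

Lemma dsimb_trans : transitive dsimb.
Proof.
by move=> B A C /asboolP AB /asboolP BC; apply/asboolP/(dsim_trans AB BC).
Qed.

Canonical dsim_equiv := EquivRel dsimb dsimb_refl dsimb_sym dsimb_trans.

Definition dirclass : Type := {eq_quot dsim_equiv}.
HB.instance Definition _ := Choice.on dirclass.

(* The ~-class of A, given a proof dA that A is directed. *)
Definition dclass (A : set G) (dA : directed A) : dirclass :=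
  \pi_{eq_quot dsim_equiv} (SigSub (mem_set dA)).

Definition carrier (X : dirclass) : set G := sval (repr (X : {eq_quot dsim_equiv})).

Lemma carrier_directed X : directed (carrier X).
Proof. exact: set_mem (svalP (repr (X : {eq_quot dsim_equiv}))). Qed.

Lemma class_eqP A B (dA : directed A) (dB : directed B) :
  dclass dA = dclass dB <-> dsim A B.
Proof. by rewrite /dclass; split => [/eqquotP/asboolP|h]; last exact/eqquotP/asboolP. Qed.

Lemma carrierK X : dclass (carrier_directed X) = X.
Proof.
rewrite /dclass -[RHS](reprK (X : {eq_quot dsim_equiv})).
by apply/eqquotP/asboolP/dsim_refl.
Qed.

Lemma carrier_class A (dA : directed A) : dsim (carrier (dclass dA)) A.
Proof. by apply/(class_eqP (carrier_directed _) dA); rewrite carrierK. Qed.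

Definition Omul (X Y : dirclass) : dirclass :=
  dclass (directed_mul (carrier_directed X) (carrier_directed Y)).

Definition Oinv (X : dirclass) : dirclass := dclass (directed_inv (carrier_directed X)).

Lemma Omul_class A B (dA : directed A) (dB : directed B) :
  Omul (dclass dA) (dclass dB) = dclass (directed_mul dA dB).
Proof. by apply/class_eqP/dsim_mul; exact: carrier_class. Qed.

Lemma Oinv_class A (dA : directed A) :
  Oinv (dclass dA) = dclass (directed_inv dA).
Proof. by apply/class_eqP/dsim_inv; exact: carrier_class. Qed.

Lemma dirclass_ind (P : dirclass -> Prop) :
  (forall A (dA : directed A), P (dclass dA)) -> forall X, P X.
Proof. by move=> h X; rewrite -(carrierK X). Qed.

Lemma OmulA : associative Omul.
Proof.
elim/dirclass_ind=> A dA; elim/dirclass_ind=> B dB; elim/dirclass_ind=> C dC.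
by rewrite !Omul_class; apply/class_eqP; rewrite set_mulA; exact: dsim_refl.
Qed.

HB.instance Definition _ := isSemigroup.Build dirclass OmulA.

Lemma Omul_inv_mul (X : dirclass) : X * Oinv X * X = X.
Proof.
elim/dirclass_ind: X => A dA; rewrite Oinv_class /monoid.mul/= !Omul_class.
exact/class_eqP/dsim_regular.
Qed.

Lemma Oinv_mul_inv (X : dirclass) : Oinv X * X * Oinv X = Oinv X.
Proof.
elim/dirclass_ind: X => A dA; rewrite Oinv_class /monoid.mul/= !Omul_class.
apply/class_eqP; rewrite -{2}(set_invK A).
exact/dsim_regular/directed_inv.
Qed.

Lemma OidemC (X Y : dirclass) : X * X = X -> Y * Y = Y -> X * Y = Y * X.
Proof.
elim/dirclass_ind: X => A dA; elim/dirclass_ind: Y => B dB.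
rewrite /monoid.mul/= !Omul_class => /class_eqP hA /class_eqP hB.
exact/class_eqP/dsim_idemC.
Qed.

Lemma Oinv_uniq (X Y : dirclass) : X * Y * X = X -> Y * X * Y = Y -> Y = Oinv X.
Proof.
move=> XYX YXY; set Z := Oinv X.
have XZX : X * Z * X = X := Omul_inv_mul X.
have ZXZ : Z * X * Z = Z := Oinv_mul_inv X.
have iXY : X * Y * (X * Y) = X * Y by rewrite mulgA XYX.
have iXZ : X * Z * (X * Z) = X * Z by rewrite mulgA XZX.
have iYX : Y * X * (Y * X) = Y * X by rewrite mulgA YXY.
have iZX : Z * X * (Z * X) = Z * X by rewrite mulgA ZXZ.
have e1 : X * Y = X * Z.
  transitivity (X * Z * (X * Y)); first by rewrite mulgA XZX.
  by rewrite (OidemC iXZ iXY) mulgA XYX.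
have e2 : Y * X = Z * X.
  transitivity (Y * X * (Z * X)); first by rewrite -mulgA (mulgA X) XZX.
  by rewrite (OidemC iYX iZX) -mulgA (mulgA X) XYX.
by rewrite -YXY e2 -mulgA e1 mulgA ZXZ.
Qed.

HB.instance Definition _ :=
  Semigroup_isInverse.Build dirclass Omul_inv_mul Oinv_mul_inv Oinv_uniq.

Lemma class_precP A B (dA : directed A) (dB : directed B) :
  prec (dclass dA) (dclass dB) <-> dprec A B.
Proof.
rewrite /prec /sinv/= !Oinv_class /monoid.mul/= !Omul_class.
by rewrite class_eqP; exact: dprec_mulP.
Qed.

Definition emb (x : G) : dirclass := dclass (directed1 x).

End DirectedClasses.

Section Groupoids.
Variable G : inverseSemigroupType.

(* The space of the universal groupoid. Its partial product, defined on (X, Y)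
   such that X^-1 X = Y Y^-1, plays no role in the topology. *)
Definition Gu : Type := dirclass G.
HB.instance Definition _ := InverseSemigroup.on Gu.

Definition Uset (x : G) : set Gu := [set X | prec X (emb x)].

Definition Ubasic (x : G) (xs : seq G) : set Gu :=
  Uset x `&` \bigcap_(y in [set` xs]) ~` Uset y.

Definition Ubase : set (set Gu) :=
  [set B | exists x (xs : seq G),
    (forall y, y \in xs -> prec y x) /\ B = Ubasic x xs].

Lemma Ubase_cover : \bigcup_(B in Ubase) B = setT.
Proof.
apply/seteqP; split=> // X _.
elim/dirclass_ind: X => A dA; have [[a Aa] _] := dA.
exists (Ubasic a [::]); first by exists a, [::].
by split=> //; apply/class_precP => _ ->; exists a.
Qed.

Lemma Ubase_join (B C : set Gu) (X : Gu) : Ubase B -> Ubase C -> B X -> C X ->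
  exists D, [/\ Ubase D, D X & D `<=` B `&` C].
Proof.
move=> [x [xs [hx ->]]] [y [ys [hy ->]]].
elim/dirclass_ind: X => A dA [/class_precP Ax nx] [/class_precP Ay ny].
have [a Aa ax] := Ax _ erefl; have [b Ab bY] := Ay _ erefl.
have [z [Az za zb]] := dA.2 _ _ Aa Ab.
have zx := prec_trans za ax; have zy := prec_trans zb bY.
pose f t := t * sinv t * z.
exists (Ubasic z (map f (xs ++ ys))); split.
- exists z, (map f (xs ++ ys)); split=> // _ /mapP[t _ ->]; exact: prec_meetr.
- split; first by apply/class_precP => _ ->; exists z.
  move=> _ /mapP[t + ->] /class_precP At.
  have [c Ac ct] := At _ erefl.
  have ft : prec (f t) t -> Uset t (dclass dA).
    by move=> h; apply/class_precP => _ ->; exists c => //; exact: prec_trans ct h.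
  rewrite mem_cat => /orP[tx|ty].
    by apply: (nx t tx); apply: ft; exact: prec_meetl (hx _ tx) zx.
  by apply: (ny t ty); apply: ft; exact: prec_meetl (hy _ ty) zy.
- move=> Y; elim/dirclass_ind: Y => E dE [/class_precP Ez nE].
  have [e Ee ez] := Ez _ erefl.
  have le t : prec z t -> Uset t (dclass dE).
    by move=> zt; apply/class_precP => _ ->; exists e => //; exact: prec_trans ez zt.
  have nt t : t \in xs ++ ys -> ~ Uset t (dclass dE).
    move=> tin /class_precP Et; have [g Eg gt] := Et _ erefl.
    have [h [Eh hg he]] := dE.2 _ _ Eg Ee.
    apply: (nE (f t)); first exact: map_f.
    apply/class_precP => _ ->; exists h => //.
    by apply: prec_meet; [exact: prec_trans hg gt|exact: prec_trans he ez].
  split; split; [exact: le| |exact: le|].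
    by move=> t tx; apply: nt; rewrite mem_cat tx.
  by move=> t ty; apply: nt; rewrite mem_cat [t \in ys]ty orbT.
Qed.

HB.instance Definition _ :=
  @isBaseTopological.Build Gu (set Gu) Ubase id Ubase_cover Ubase_join.

Lemma Ubase_basis : basis Ubase.
Proof.
split; first by move=> B hB; exists [set B]; [move=> _ ->|rewrite bigcup_set1].
move=> X N; rewrite nbhsE => -[W [[D hD <-] [B DB BX]] WN].
by exists B; [split=> //; exact: hD|move=> Y BY; apply: WN; exists B].
Qed.

Definition Gm : set Gu := [set X | minimal X].

(* [Gm], coerced to the type [set_type Gm], has the subspace topology; [Vset x] is
   [Uset x `&` Gm] as a subset of that type. *)
Definition Vset (x : G) : set Gm := [set X | Uset x (set_val X)].

End Groupoids.

(* Main.v *)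
(** Let X = [A] be minimal in O(G), with A ≺ x and not A ≺ y, where y ≺ x.
  Then some a in A with a ≺ x has only zero in common with y: since a and y are
  both below x, a a^-1 y is their largest common precessor, and if none of
  these elements were zero they would form a directed set B with 0 <> [B] ≺ X,
  so that [B] = X by minimality, and A ≺ B ≺ y.  Doing this for each of
  y = x_1, ..., x_n and taking a common lower bound w in A gives an element with
  X in V_w, and V_w is contained in U_(x; x_1, ..., x_n). *)

Require Import Defs.
From mathcomp Require Import all_boot classical_sets topology.
From mathcomp Require Import boolp functions.

Local Open Scope classical_set_scope.
Local Open Scope group_scope.

Section MinimalClasses.
Local Set Implicit Arguments.
Local Unset Strict Implicit.

Variable G : inverseSemigroupType.
Implicit Types (x y z w : G) (A : set G).

Lemma dclass_prec_emb A (dA : directed A) x :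
  prec (dclass dA) (emb x) <-> exists2 a, A a & prec a x.
Proof. by rewrite class_precP; split=> [/(_ x erefl)|h _ ->]. Qed.

Lemma is_zero_prec x z : is_zero z -> prec x z -> is_zero x.
Proof. by move=> z0 xz y; exact: prec_trans xz (z0 y). Qed.

Lemma dclass_zero A (dA : directed A) a : A a -> is_zero a -> is_zero (dclass dA).
Proof.
move=> Aa a0; elim/dirclass_ind=> B dB; apply/class_precP => b _.
by exists a => //; exact: a0.
Qed.

Lemma zero_dclass A (dA : directed A) :
  has_zero G -> is_zero (dclass dA) -> exists2 a, A a & is_zero a.
Proof.
move=> [z z0] /(_ (emb z)) /dclass_prec_emb[a Aa az].
by exists a => //; exact: is_zero_prec az.
Qed.

(** The set [B] of the overview: for [a] and [y] both below [x], [a * sinv a * y] is their largest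
    common precessor. *)
Definition meets A x y : set G :=
  [set a * sinv a * y | a in [set a | A a /\ prec a x]].

(** [a * sinv a * y] is monotone in [a], and a lower bound of indices below [x] is again below
    [x]. *)
Lemma directed_meets A x y :
  directed A -> (exists2 a, A a & prec a x) -> directed (meets A x y).
Proof.
move=> dA [a Aa ax]; split; first by exists (a * sinv a * y); exists a.
move=> _ _ [b [Ab bx] <-] [c [Ac cx] <-].
have [d [Ad db dc]] := dA.2 _ _ Ab Ac.
have dx := prec_trans db bx.
exists (d * sinv d * y); split; first by exists d.
- by apply: prec_mul (precxx y); apply: prec_mul db (prec_inv db).
- by apply: prec_mul (precxx y); apply: prec_mul dc (prec_inv dc).
Qed.

Lemma minimal_separate A (dA : directed A) x y :
  has_zero G -> minimal (dclass dA) ->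
  prec (dclass dA) (emb x) -> prec y x -> ~ prec (dclass dA) (emb y) ->
  exists a, [/\ A a, prec a x & is_zero (a * sinv a * y)].
Proof.
move=> H0 [_ minA] /dclass_prec_emb Ax yx nAy; apply: contrapT => nz.
have dB := directed_meets y dA Ax.
have BA : prec (dclass dB) (dclass dA).
  apply/class_precP => a Aa; have [b Ab bx] := Ax.
  (* The index [c] must lie below [x] as well as below [a], so that [c * sinv c * y] lies below
     [c]. *)
  have [c [Ac ca cb]] := dA.2 _ _ Aa Ab.
  have cx := prec_trans cb bx.
  exists (c * sinv c * y); first by exists c.
  exact: prec_trans (prec_meetl cx yx) ca.
(* Minimality replaces [A] by [meets A x y], whose elements lie below [y]; the second goal is that
   this class is nonzero. *)
apply: nAy; rewrite -(minA _ BA).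
  apply/dclass_prec_emb; have [a Aa ax] := Ax.
  by exists (a * sinv a * y); [exists a|exact: prec_meetr].
move=> /(zero_dclass H0)[_ [a [Aa ax] <-] a0].
by apply: nz; exists a.
Qed.

Lemma minimal_separates A (dA : directed A) x (xs : seq G) :
  has_zero G -> minimal (dclass dA) -> prec (dclass dA) (emb x) ->
  (forall y, y \in xs -> prec y x) ->
  (forall y, y \in xs -> ~ prec (dclass dA) (emb y)) ->
  exists w, [/\ A w, prec w x &
    forall y, y \in xs -> is_zero (w * sinv w * y)].
Proof.
move=> H0 mA Ax; elim: xs => [|y ys IH] yx nAy.
  by move: Ax => /dclass_prec_emb[a Aa ax]; exists a.
have [|z zys|w [Aw wx w0]] := IH; first by move=> z zys; apply: yx; rewrite inE zys orbT.
  by apply: nAy; rewrite inE zys orbT.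
have yin : y \in y :: ys by rewrite inE eqxx.
have [a [Aa ax a0]] := minimal_separate H0 mA Ax (yx _ yin) (nAy _ yin).
have [c [Ac ca cw]] := dA.2 _ _ Aa Aw.
(* Passing to the lower bound [c] keeps each product below one already known to be zero. *)
have mono b z : prec c b -> prec (c * sinv c * z) (b * sinv b * z).
  by move=> cb; apply: prec_mul (precxx z); exact: prec_mul cb (prec_inv cb).
exists c; split=> //; first exact: prec_trans ca ax.
move=> z; rewrite inE => /orP[/eqP ->|/w0 z0].
  exact: is_zero_prec a0 (mono _ _ ca).
exact: is_zero_prec z0 (mono _ _ cw).
Qed.

(** A lower bound in [A] of elements below [w] and [y] is below [w * sinv w * y], hence zero, and a
    directed set containing a zero has zero class. *)
Lemma zero_meet_disjoint (X : dirclass G) w y : ~ is_zero X ->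
  prec X (emb w) -> is_zero (w * sinv w * y) -> ~ prec X (emb y).
Proof.
elim/dirclass_ind: X => A dA nX /dclass_prec_emb[a Aa aw] wy0.
move=> /dclass_prec_emb[b Ab b_y]; apply: nX.
have [c [Ac ca cb]] := dA.2 _ _ Aa Ab.
apply: dclass_zero Ac _; apply: is_zero_prec wy0 _.
by apply: prec_meet; [exact: prec_trans ca aw|exact: prec_trans cb b_y].
Qed.

Lemma Uset_open x : open (Uset x).
Proof.
(* This is the basic set with nothing removed. *)
apply: (Ubase_basis G).1; exists x, [::]; split=> //.
by apply/seteqP; split=> [X Xx|X []].
Qed.

Lemma Uset_basis_minimal (X : Gu G) (N : set (Gu G)) :
  has_zero G -> minimal X -> nbhs X N ->
  exists2 w, Uset w X & Uset w `&` Gm (G := G) `<=` N.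
Proof.
move=> H0 mX /(Ubase_basis G).2[_ [[x [xs [hx ->]]] Xx] BN].
elim/dirclass_ind: X mX Xx => A dA mA [Ax nA].
have [w [Aw wx w0]] := minimal_separates H0 mA Ax hx nA.
exists w; first by apply/dclass_prec_emb; exists w.
(* Being nonzero, [Y] cannot lie below both [w] and an element of [xs]. *)
move=> Y [Yw [nY _]]; apply: BN; split.
  by apply: prec_trans Yw _; apply/dclass_prec_emb; exists w.
by move=> y /w0 wy0; exact: zero_meet_disjoint wy0.
Qed.

End MinimalClasses.

Theorem lemma6p7 (G : inverseSemigroupType) (HL : conditionL G)
  (H0 : has_zero G) : basis [set Vset x | x in [set: G]].
Proof.
split; first by move=> _ [x _ <-]; exists (Uset x) => //; exact: Uset_open.
(* [W] is an open set of [Gu G] whose trace on [Gm] is contained in [N]. *)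
move=> X N [_ [[W oW <-] WX WN]].
have mX : minimal (set_val X) := set_valP X.
have [w Xw wW] := @Uset_basis_minimal G _ W H0 mX (open_nbhs_nbhs (conj oW WX)).
exists (Vset w); first by split=> //; exists w.
move=> Y Yw; apply: WN; apply: wW; split=> //.
exact: set_valP Y.
Qed.
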